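(* Let the action of a right amenable semitopological semigroup $G$ on $K$ be uniquely ergodic with invariant probability measure $\mu$ and suppose that $\Omega$ is a compact group with Haar measure $\eta$ and $\gamma:G\times K\to\Omega$ a continuous cocycle. If the skew product action $(g,(x,\omega))\mapsto(gx,\omega\gamma(g,x))$ of $G$ on $K\times\Omega$ is ergodic with respect to the product measure $\mu\times\eta$, then it is uniquely ergodic.
   Context: $K$ is a compact (Hausdorff) space; $\eta$ is the normalized Haar measure. A semitopological semigroup is a semigroup with a topology making multiplication separately continuous. $G$ is right amenable if there is $m\in C_b(G)'$ with $\langle m,\mathbf 1\rangle=\|m\|=1$ and $\langle m,R_gf\rangle=\langle m,f\rangle$ for all $g\in G,f\in C_b(G)$, where $R_gf(h)=f(hg)$. An action of $G$ on a compact space $L$ is a continuous map $G\times L\to L$, $(g,x)\mapsto gx$, with $(g_1g_2)x=g_1(g_2x)$. A measure $\mu$ on $L$ is $G$-invariant if $\mu(A)=\mu(\{x:gx\in A\})$ for all Borel sets $A$ and $g\in G$. The action is uniquely ergodic if there is a unique $G$-invariant (regular Borel) probability measure on $L$. It is ergodic with respect to an invariant measure $\mu$ if there is no non-trivial measurable $G$-invariant set, equivalently if the common fixed space in $L^2(L,\mu)$ of the extended Koopman operators $f\mapsto f(g\,\cdot)$, $g\in G$, is $\mathbb C\cdot\mathbf 1$. A continuous cocycle is a continuous map $\gamma:G\times K\to\Omega$ with $\gamma(g_1g_2,x)=\gamma(g_2,x)\gamma(g_1,g_2x)$ for all $g_1,g_2\in G$, $x\in K$. *)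

(* Defs.v *)
From HB Require Import structures.
From mathcomp Require Import all_boot all_order all_algebra.
From mathcomp Require Import all_classical all_reals all_analysis.
From mathcomp Require Import complex.

Set Implicit Arguments.
Unset Strict Implicit.
Unset Printing Implicit Defensive.

Import Order.TTheory GRing.Theory Num.Theory.
Import numFieldNormedType.Exports.

Local Open Scope classical_set_scope.
Local Open Scope ring_scope.

HB.structure Definition PreTopologicalSemigroup :=
  {G of Topological G & Semigroup G}.

(* No Hausdorff axiom is imposed, neither here nor on topological groups. *)
HB.mixin Record isSemitopologicalSemigroup G
    & Topological G & Semigroup G := {
  mulg_continuousr : forall g : G, continuous (fun h : G => (g * h)%g) ;
  mulg_continuousl : forall h : G, continuous (fun g : G => (g * h)%g)
}.

#[short(type="semitopologicalSemigroupType")]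
HB.structure Definition SemitopologicalSemigroup :=
  {G of Topological G & Semigroup G & isSemitopologicalSemigroup G}.

HB.mixin Record isTopologicalGroup G & Topological G & Group G := {
  mulg_continuous : continuous (fun p : G * G => (p.1 * p.2)%g) ;
  invg_continuous : continuous (fun g : G => (g^-1)%g)
}.

(* [g_sigma_algebraType] needs a point; this is harmless, as a group has a unit. *)
#[short(type="topologicalGroupType")]
HB.structure Definition TopologicalGroup :=
  {G of PointedTopological G & Group G & isTopologicalGroup G}.

HB.saturate prod.

Notation borel T := (g_sigma_algebraType (@open (T : ptopologicalType))).

Section Amenability.
Variables (R : realType) (G : semitopologicalSemigroupType).

Definition Cb : set (G -> R[i]^o) :=
  [set f | continuous f /\ bounded_fun f].

Definition Cb_linear (m : (G -> R[i]^o) -> R[i]) : Prop :=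
  forall (a : R[i]) (f g : G -> R[i]^o), Cb f -> Cb g ->
    m (fun h => a * f h + g h) = a * m f + m g.

(* The dual norm on [C_b(G)'].  [`|z|] is a complex number with null imaginary
   part, and [Re] extracts its value. *)
Definition Cb_dual_norm (m : (G -> R[i]^o) -> R[i]) : \bar R :=
  ereal_sup [set (complex.Re `|m f|)%:E |
    f in [set f | Cb f /\ forall h, `|f h| <= 1]].

(* Elements of [C_b(G)'] are represented by functions on all of [G -> R[i]], of
   which only the values on [C_b(G)] matter. *)
Definition right_amenable : Prop :=
  exists m : (G -> R[i]^o) -> R[i],
    [/\ Cb_linear m,
        m (fun=> 1) = 1,
        Cb_dual_norm m = 1%E
      & forall (g : G) (f : G -> R[i]^o), Cb f ->
          m (fun h => f (h * g)%g) = m f].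

End Amenability.

Section Actions.
Variables (G : semitopologicalSemigroupType).

Definition is_action (L : topologicalType) (act : G -> L -> L) : Prop :=
  continuous (fun p : G * L => act p.1 p.2) /\
  forall g1 g2 x, act (g1 * g2)%g x = act g1 (act g2 x).

Definition is_cocycle (K : topologicalType) (Omega : topologicalGroupType)
    (act : G -> K -> K) (gamma : G -> K -> Omega) : Prop :=
  continuous (fun p : G * K => gamma p.1 p.2) /\
  forall g1 g2 x, gamma (g1 * g2)%g x = (gamma g2 x * gamma g1 (act g2 x))%g.

Definition skew_product (K : topologicalType) (Omega : topologicalGroupType)
    (act : G -> K -> K) (gamma : G -> K -> Omega) (g : G)
    (p : (K * Omega)%type) : (K * Omega)%type :=
  (act g p.1, (p.2 * gamma g p.1)%g).

End Actions.

Definition regular_measure (R : realType) (L : ptopologicalType)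
    (mu : probability (borel L) R) : Prop :=
  forall A : set (borel L), measurable A ->
    mu A = ereal_inf [set mu U | U in [set U : set L | open U /\ A `<=` U]] /\
    mu A = ereal_sup [set mu C | C in [set C : set L | compact C /\ C `<=` A]].

Section Ergodicity.
Variables (R : realType) (G : semitopologicalSemigroupType).
Variables (L : ptopologicalType) (act : G -> L -> L).
Implicit Type mu : probability (borel L) R.

Definition invariant_measure mu : Prop :=
  forall (g : G) (A : set (borel L)), measurable A ->
    mu A = mu (act g @^-1` A).

(* Uniqueness is tested on Borel sets only, because a [probability] also carries
   meaningless values on non-measurable sets. *)
Definition uniquely_ergodic_with mu : Prop :=
  [/\ regular_measure mu, invariant_measure mu
    & forall nu : probability (borel L) R,
        regular_measure nu -> invariant_measure nu ->
        forall A : set (borel L), measurable A -> nu A = mu A].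

Definition uniquely_ergodic : Prop :=
  exists mu : probability (borel L) R, uniquely_ergodic_with mu.

(* Invariance of a set is understood modulo null sets, for each [g] separately:
   this is the notion that corresponds to the common fixed space of the Koopman
   operators on [L^2] for an arbitrary (possibly uncountable) [G]. *)
Definition ergodic mu : Prop :=
  forall A : set (borel L), measurable A ->
    (forall g : G, mu (A `+` act g @^-1` A) = 0%E) ->
    mu A = 0%E \/ mu A = 1%E.

End Ergodicity.

Arguments uniquely_ergodic R {G L} act.

(* Left invariance suffices: on a compact group the left Haar measure is also
   right invariant. *)
Definition normalized_haar (R : realType) (Omega : topologicalGroupType)
    (eta : probability (borel Omega) R) : Prop :=
  regular_measure eta /\
  forall (w : Omega) (A : set (borel Omega)), measurable A ->
    eta [set (w * v)%g | v in A] = eta A.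

(* The product of regular Borel measures, as a regular measure on the Borel sets
   of the product space; these may form a larger sigma-algebra than the product
   of the Borel sigma-algebras, on which [mu \x eta] lives, when the spaces are
   not second countable.  It is determined by its values on rectangles. *)
Definition is_product_measure (R : realType) (K Omega : ptopologicalType)
    (mu : probability (borel K) R) (eta : probability (borel Omega) R)
    (nu : probability (borel (K * Omega)%type) R) : Prop :=
  regular_measure nu /\
  forall (A : set (borel K)) (B : set (borel Omega)),
    measurable A -> measurable B -> nu (A `*` B) = (mu A * eta B)%E.

(* Main.v *)
Require Import Defs.
From HB Require Import structures.
From mathcomp Require Import all_boot all_order all_algebra.
From mathcomp Require Import finmap lra.
From mathcomp Require Import all_classical all_reals all_analysis.
From mathcomp Require Import measurable_realfun.

(** Unique ergodicity of an ergodic compact group extension.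

    Write [S_g] for the skew product and [rot w] for the rotation
    [(x, v) |-> (x, w v)] of [K * Omega].  The cocycle multiplies on the right
    and [rot w] on the left, so they commute.  Let [lam] be a regular invariant
    probability; it has to be shown that [lam] is the product measure [nu].

    - The projection of [lam] to [K] is regular and invariant, hence equals
      [mu].  Averaging the images of [lam] under all rotations replaces each
      fibre measure by Haar measure, so that
      [\int lam (rot w @^-1` B) d eta(w) = nu B] ([haar_average]).
    - Averaging only over an open neighbourhood [V] of [1] gives a measure that
      is still invariant and is dominated by [nu].  An ergodic measure is the
      only invariant probability absolutely continuous with respect to it
      ([ergodic_extremal]), so this local average is [eta V * nu B]
      ([local_haar_average]).  Its density [h] with respect to [nu] cannot
      exceed [1] on a set of positive measure, since [{h > 1}] is invariant
      modulo null sets.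
    - For [U] open, [w |-> lam (rot w @^-1` U)] is lower semicontinuous, so if
      [lam U] were larger than [nu U] this function would be uniformly larger
      than [nu U] near [w = 1], against the value of its local averages.  Hence
      [lam <= nu] on open sets ([invariant_le_product]), on Borel sets by outer
      regularity, and comparable probabilities are equal.

    The exchange of integrals behind the first point is delicate: without
    countable bases the Borel sets of a product need not belong to the product
    of the Borel sigma-algebras, where the usual Fubini theorem lives.
    Regularity makes up for this.  A Borel set that is null near each of its
    points is null ([regular_locally_null]); together with an exhaustion
    argument, this shows that both iterated integrals of an open set are limits
    of their values on unions of rectangles inside it, so that measures on the
    Borel sets of a product are determined by open rectangles
    ([rect_smooth_unique]).  This yields [fubini_borel], the fibre integral
    formula [regular_productE] for [nu], and, on [{(v, w) | v w \in A}], the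
    right invariance of Haar measure. *)

Set Implicit Arguments.
Unset Strict Implicit.
Unset Printing Implicit Defensive.

Import Order.TTheory GRing.Theory Num.Theory.
Import numFieldNormedType.Exports.

Local Open Scope classical_set_scope.
Local Open Scope ring_scope.

(** * Topology of products and compact sets *)

Lemma continuous_compose (X Y Z : topologicalType) (f : X -> Y) (g : Y -> Z) :
  continuous f -> continuous g -> continuous (fun x => g (f x)).
Proof. by move=> cf cg x; apply: continuous_comp; [exact: cf|exact: cg]. Qed.

Lemma continuous_pair (T X Y : topologicalType) (f : T -> X) (g : T -> Y) :
  continuous f -> continuous g -> continuous (fun t => (f t, g t)).
Proof. by move=> cf cg t; apply: cvg_pair; [exact: cf|exact: cg]. Qed.

Lemma continuous_slice (X Y : topologicalType) (x : X) :
  continuous (fun y : Y => (x, y)).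
Proof.
by apply: continuous_pair => t; [exact: cst_continuous|exact: cvg_id].
Qed.

Lemma continuous_coslice (X Y : topologicalType) (y : Y) :
  continuous (fun x : X => (x, y)).
Proof.
by apply: continuous_pair => t; [exact: cvg_id|exact: cst_continuous].
Qed.

Lemma continuous_fst (X Y : topologicalType) : continuous (@fst X Y).
Proof. by move=> p; exact: cvg_fst. Qed.

Lemma continuous_snd (X Y : topologicalType) : continuous (@snd X Y).
Proof. by move=> p; exact: cvg_snd. Qed.

Lemma open_rect (X Y : topologicalType) (A : set X) (B : set Y) :
  open A -> open B -> open (A `*` B).
Proof.
move=> oA oB; have /continuousP cf := @continuous_fst X Y.
have /continuousP cs := @continuous_snd X Y.
by apply: openI; [exact: cf|exact: cs].
Qed.

Lemma open_subrect (X Y : ptopologicalType) (U : set (X * Y)) p :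
  open U -> U p ->
  exists (A : set X) (B : set Y),
    [/\ open A, open B, (A `*` B) p & A `*` B `<=` U].
Proof.
move=> oU Up; have [[A B]/= [nA nB] ABU] := open_nbhs_nbhs (conj oU Up).
exists A°, B°; split; [exact: open_interior|exact: open_interior| |].
  by split; exact: nbhs_singleton (nbhs_interior _).
by move=> [x y] [/= /interior_subset Ax /interior_subset By]; exact: ABU.
Qed.

Lemma hausdorff_prod (X Y : ptopologicalType) :
  hausdorff_space X -> hausdorff_space Y -> hausdorff_space (X * Y)%type.
Proof.
move=> hX hY [x y] [x' y'] clxy; congr pair.
- apply: hX => A B nA nB.
  have [||p [[/= Ap _] [/= Bp _]]] := clxy (A `*` setT) (B `*` setT).
  + by exists (A, setT) => //; split => //; exact: filterT.
  + by exists (B, setT) => //; split => //; exact: filterT.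
  by exists p.1.
- apply: hY => A B nA nB.
  have [||p [[/= _ Ap] [/= _ Bp]]] := clxy (setT `*` A) (setT `*` B).
  + by exists (setT, A) => //; split => //; exact: filterT.
  + by exists (setT, B) => //; split => //; exact: filterT.
  by exists p.2.
Qed.

(** Compactness as an induction principle: a property of sets that is stable
    under binary unions and holds locally holds near the whole compact set. *)
Lemma compact_open_cover_ind (T : ptopologicalType) (C : set T)
    (Q : set T -> Prop) :
  compact C -> Q set0 ->
  (forall U V, Q U -> Q V -> Q (U `|` V)) ->
  (forall x, C x -> exists V, [/\ open V, V x & Q V]) ->
  exists V, [/\ open V, C `<=` V & Q V].
Proof.
rewrite compact_cover => cC Q0 QU locQ.
have /choice[V HV] : forall x, exists V : set T, C x -> [/\ open V, V x & Q V].
  move=> x; have [/locQ[V HV]|nCx] := pselect (C x); first by exists V.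
  by exists set0.
have [||D DC CD] := cC T C V.
- by move=> x /HV[].
- by move=> x Cx; exists x => //; have [] := HV x Cx.
exists (\bigcup_(x in [set` D]) V x); split => //.
  by apply: bigcup_open => x /DC /set_mem /HV[].
by rewrite bigcup_fset big_seq; elim/big_ind : _ => // x /DC /set_mem /HV[].
Qed.

(** * Borel sets and images of measures *)

Section Borel.
Variable R : realType.

Lemma open_borel (X : ptopologicalType) (U : set X) :
  open U -> measurable (U : set (borel X)).
Proof. exact: sub_sigma_algebra. Qed.

Lemma compact_borel (X : ptopologicalType) (C : set X) :
  hausdorff_space X -> compact C -> measurable (C : set (borel X)).
Proof.
move=> hX cC; rewrite -[C]setCK; apply: measurableC.
by apply: open_borel; rewrite openC; exact: compact_closed.
Qed.

Lemma continuous_borel (X Y : ptopologicalType) (f : X -> Y) :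
  continuous f -> measurable_fun setT (f : borel X -> borel Y).
Proof.
move=> /continuousP cf; apply: measurability => //.
by move=> _ [U oU <-]; rewrite setTI; apply: open_borel; exact: cf.
Qed.

Lemma borel_preimage (X Y : ptopologicalType) (f : X -> Y)
    (A : set (borel Y)) :
  continuous f -> measurable A -> measurable (f @^-1` A : set (borel X)).
Proof.
by move=> cf mA; rewrite -[X in measurable X]setTI; exact: continuous_borel.
Qed.

Definition image_prob (X Y : ptopologicalType) (f : X -> Y)
  (cf : continuous f) (P : probability (borel X) R) :
    probability (borel Y) R :=
  let mf : {mfun (borel X) >-> (borel Y)} :=
    HB.pack (f : borel X -> borel Y)
      (isMeasurableFun.Build _ _ _ _ _ (continuous_borel cf)) in
  distribution P mf.

Lemma image_probE (X Y : ptopologicalType) (f : X -> Y) (cf : continuous f)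
  (P : probability (borel X) R) A : image_prob cf P A = P (f @^-1` A).
Proof. by []. Qed.

Lemma integral_image (X Y : ptopologicalType) (f : X -> Y)
    (P : probability (borel X) R) (P' : probability (borel Y) R)
    (F : borel Y -> \bar R) :
  continuous f -> (forall A, measurable A -> P' A = P (f @^-1` A)) ->
  measurable_fun setT F -> (forall y, 0 <= F y)%E ->
  (\int[P]_x F (f x) = \int[P']_y F y)%E.
Proof.
move=> cf P'E mF F0; rewrite (eq_measure_integral (image_prob cf P)).
  by rewrite ge0_integral_pushforward//; exact: continuous_borel.
by move=> A mA _; exact: P'E.
Qed.

End Borel.

(** * Regular measures *)

Section Regular.
Local Open Scope ereal_scope.
Variable R : realType.

Lemma regular_inner (X : ptopologicalType) (P : probability (borel X) R)
    (A : set (borel X)) t :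
  regular_measure P -> measurable A -> t < P A ->
  exists C : set X, [/\ compact C, C `<=` A & t < P C].
Proof.
move=> rP mA; have [_ PA] := rP A mA.
by rewrite PA => /ereal_sup_gt[_ [C [cC CA] <-] tC]; exists C.
Qed.

Lemma regular_outer (X : ptopologicalType) (P : probability (borel X) R)
    (A : set (borel X)) t :
  regular_measure P -> measurable A -> P A < t ->
  exists U : set X, [/\ open U, A `<=` U & P U < t].
Proof.
move=> rP mA; have [PA _] := rP A mA.
by rewrite PA => /ereal_inf_lt[_ [C [cC CA] <-] tC]; exists C.
Qed.

(** Outer regularity comes for free: compact sets are closed and the measure is
    finite, so inner approximations of the complement give outer ones. *)
Lemma inner_regular_measure (X : ptopologicalType)
    (P : probability (borel X) R) :
  hausdorff_space X ->
  (forall (A : set (borel X)) t, measurable A -> t < P A ->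
    exists C : set X, [/\ compact C, C `<=` A & t < P C]) ->
  regular_measure P.
Proof.
move=> hX inP A mA; split; apply/eqP; rewrite eq_le; apply/andP; split.
- apply: le_ereal_inf_tmp => _ [U [oU AU] <-].
  by apply: le_measure => //; rewrite inE//; exact: open_borel.
- apply/lee_addgt0Pr => e e0.
  have fA : P A \is a fin_num by exact: fin_num_measure.
  have : 1 - (P A + e%:E) < P (~` A).
    rewrite probability_setC// -(fineK fA) -EFinD -!EFinB lte_fin.
    by rewrite ltrD2l ltrN2 ltrDl.
  move=> /(inP _ _ (measurableC mA))[C [cC CA ltC]].
  have mC := compact_borel hX cC.
  apply: (@le_trans _ _ (P (~` C))).
    apply: ereal_inf_lbound; exists (~` C) => //; split.
      by rewrite openC; exact: compact_closed.
    by move=> x Ax /CA.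
  have fC : P C \is a fin_num by exact: fin_num_measure.
  move: ltC; rewrite probability_setC// -(fineK fA) -(fineK fC).
  rewrite -EFinD -!EFinB lte_fin lee_fin => ltC.
  by lra.
- rewrite leNgt; apply/negP => /(inP _ _ mA)[C [cC CA]].
  apply/negP; rewrite -leNgt; apply: ereal_sup_ubound.
  by exists C.
- apply: ge_ereal_sup => _ [C [cC CA] <-].
  by apply: le_measure => //; rewrite inE//; exact: compact_borel.
Qed.

Lemma regular_image (X Y : ptopologicalType) (f : X -> Y) (cf : continuous f)
    (P : probability (borel X) R) :
  hausdorff_space X -> hausdorff_space Y ->
  regular_measure P -> regular_measure (image_prob cf P).
Proof.
move=> hX hY rP; apply: inner_regular_measure => // A t mA.
rewrite image_probE => tA.
have [C [cC CA tC]] := regular_inner rP (borel_preimage cf mA) tA.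
have cfC : compact (f @` C).
  by apply: continuous_compact => //; exact: continuous_subspaceT.
exists (f @` C); split => //.
  by move=> _ [x /CA Ax <-].
apply: (lt_le_trans tC); rewrite image_probE.
apply: le_measure; rewrite ?inE; first exact: compact_borel.
  by apply: borel_preimage => //; exact: compact_borel.
by move=> x Cx; exists x.
Qed.

(** Regularity replaces a countable base here: a compact subset of [E] is
    covered by finitely many of the null pieces. *)
Lemma regular_locally_null (X : ptopologicalType)
    (P : probability (borel X) R) (E : set (borel X)) :
  hausdorff_space X -> regular_measure P -> measurable E ->
  (forall x, E x -> exists V : set X, [/\ open V, V x & P (E `&` V) = 0]) ->
  P E = 0.
Proof.
move=> hX rP mE locE; apply/eqP; rewrite eq_le measure_ge0 andbT leNgt.
apply/negP => /(regular_inner rP mE)[C [cC CE]].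
have [||x /CE /locE//|V [oV CV EV0]] := @compact_open_cover_ind _ C
   (fun V => measurable (V : set (borel X)) /\ P (E `&` V) = 0) cC.
- by rewrite setI0 measure0; split.
- move=> U V [mU U0] [mV V0]; split; first exact: measurableU.
  by rewrite setIUr measureU0 //; exact: measurableI.
- move=> [V [oV Vx V0]]; exists V; split=> //; split => //.
  exact: open_borel.
apply/negP; rewrite -leNgt -(EV0.2); apply: le_measure; rewrite ?inE//.
- exact: compact_borel.
- by apply: measurableI => //; exact: open_borel.
- by move=> x Cx; split; [exact: CE|exact: CV].
Qed.

End Regular.

(** * Mixtures of measures and iterated integrals *)

Section Mixture.
Local Open Scope ereal_scope.
Context d d' (T : measurableType d) (Z : measurableType d') (R : realType).
Variables (m : {measure set T -> \bar R}) (D : set T) (mD : measurable D).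
Variables (k : T -> {measure set Z -> \bar R}).
Hypothesis mk : forall A, measurable A -> measurable_fun [set: T] (k ^~ A).

(** The measurability proofs are arguments so that the measure structure below
    can be inferred from the term. *)
Definition mixture of measurable D &
  (forall A, measurable A -> measurable_fun [set: T] (k ^~ A)) :=
  fun A => \int[m]_(x in D) k x A.

Local Notation mix := (mixture mD mk).

Let mixture0 : mix set0 = 0.
Proof. by rewrite /mixture integral0_eq// => y _; rewrite measure0. Qed.

Let mixture_ge0 A : 0 <= mix A. Proof. exact: integral_ge0. Qed.

Let mixture_sigma_additive : semi_sigma_additive mix.
Proof.
move=> U mU tU mUU; rewrite [X in _ --> X](_ : _ =
  \int[m]_(y in D) (\sum_(n <oo) k y (U n))); last first.
  apply: eq_integral => V _.
  by apply/esym/cvg_lim => //; exact/measure_semi_sigma_additive.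
apply/cvg_closeP; split.
  by apply: is_cvg_nneseries => n _ _; exact: integral_ge0.
rewrite closeE// integral_nneseries// => n.
by apply: measurable_funS (mk (mU n)).
Qed.

HB.instance Definition _ := isMeasure.Build _ _ R
  mix mixture0 mixture_ge0 mixture_sigma_additive.

End Mixture.

Section Slices.
Local Open Scope ereal_scope.
Variables (R : realType) (X Y : ptopologicalType).
Hypothesis hY : hausdorff_space Y.
Variable Q : probability (borel Y) R.
Hypothesis rQ : regular_measure Q.

Lemma measurable_slice (x : X) (B : set (borel (X * Y)%type)) :
  measurable B -> measurable ([set y | B (x, y)] : set (borel Y)).
Proof. exact: (borel_preimage (@continuous_slice X Y x)). Qed.

(** The tube lemma, applied to a compact subset of the slice of almost full
    measure.  This is the lower semicontinuity of [x |-> Q U_x], with a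
    rectangle as a witness. *)
Lemma slice_subrect (U : set (X * Y)) x t :
  open U -> t < Q [set y | U (x, y)] ->
  exists (A : set X) (B : set Y),
    [/\ open A, open B, A x, A `*` B `<=` U & t < Q B].
Proof.
move=> oU /(regular_inner rQ)[|C [cC CU tC]].
  by apply: measurable_slice; exact: open_borel.
have [||y Cy|B [oB CB [A [oA Ax ABU]]]] := @compact_open_cover_ind _ C
   (fun B => exists A : set X, [/\ open A, A x & A `*` B `<=` U]) cC.
- by exists setT; split => //; [exact: openT|move=> ? []].
- move=> B1 B2 [A1 [oA1 A1x A1U]] [A2 [oA2 A2x A2U]].
  exists (A1 `&` A2); split; [exact: openI|by split|].
  by move=> [a b] [/= [A1a A2a] [?|?]]; [exact: A1U|exact: A2U].
- have [A [B [oA oB [/= Ax By] ABU]]] := open_subrect oU (CU _ Cy).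
  by exists B; split => //; exists A.
exists A, B; split => //; apply: (lt_le_trans tC).
apply: le_measure => //; rewrite inE; last exact: open_borel.
exact: compact_borel.
Qed.

(** Semicontinuous for open [B], hence measurable for Borel [B] by the pi-lambda
    theorem. *)
Lemma measurable_slice_measure (B : set (borel (X * Y)%type)) :
  measurable B ->
  measurable_fun setT ((fun x => Q [set y | B (x, y)]) : borel X -> \bar R).
Proof.
move: B; apply: (@dynkin_induction _ (borel (X * Y)%type) (@open (X * Y)%type)
  (fun B => measurable_fun setT
    ((fun x => Q [set y | B (x, y)]) : borel X -> \bar R))) => //.
- exact: openI.
- by apply: (eq_measurable_fun (cst (Q setT))).
- move=> U oU; apply: (measurability _ (ErealGenOInfty.measurableE R)) => //.
  move=> _ [_ [t ->] <-]; rewrite setTI; apply: open_borel.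
  rewrite openE => x /=; rewrite in_itv/= andbT => tU.
  have [A [B [oA oB Ax ABU tB]]] := slice_subrect oU tU.
  apply: filterS (open_nbhs_nbhs (conj oA Ax)) => x' Ax' /=.
  rewrite in_itv/= andbT (lt_le_trans tB)//; apply: le_measure.
  + by rewrite inE; exact: open_borel.
  + by rewrite inE; apply: measurable_slice; exact: open_borel.
  + by move=> y By; exact: ABU.
- move=> B mB mfB.
  apply: (eq_measurable_fun (fun x : borel X => 1 - Q [set y | B (x, y)])).
    by move=> x _; rewrite -probability_setC//; exact: measurable_slice.
  by apply: emeasurable_funB.
- move=> F mF tF mfF.
  apply: (eq_measurable_fun
    (fun x : borel X => \sum_(n <oo) Q [set y | F n (x, y)])).
    move=> x _.
    rewrite (_ : [set y | _] = \bigcup_n [set y | F n (x, y)])//.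
    rewrite measure_semi_bigcup//.
    + by move=> n; exact: measurable_slice.
    + by move=> i j _ _ [y [/= Fi Fj]]; apply: (tF i j I I); exists (x, y).
    + by apply: bigcup_measurable => n _; exact: measurable_slice.
  exact: ge0_emeasurable_sum.
Qed.

Definition slice_measure (x : borel X) :
    {measure set (borel (X * Y)%type) -> \bar R} :=
  image_prob (@continuous_slice X Y x) Q.

Lemma measurable_slice_kernel (B : set (borel (X * Y)%type)) :
  measurable B -> measurable_fun [set: borel X] (slice_measure ^~ B).
Proof. exact: measurable_slice_measure. Qed.

Definition iterated (P : probability (borel X) R) :
    {measure set (borel (X * Y)%type) -> \bar R} :=
  mixture P measurableT measurable_slice_kernel.

Lemma iteratedE P B :
  iterated P B = \int[P]_x Q [set y | B (x, y)].
Proof. by []. Qed.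

Lemma iterated_rect P (A : set (borel X)) (B : set (borel Y)) :
  measurable A -> measurable B -> iterated P (A `*` B) = P A * Q B.
Proof.
move=> mA mB; rewrite iteratedE.
transitivity (\int[P]_x (Q B * (\1_A x)%:E)).
  apply: eq_integral => x _; rewrite indicE.
  have [xA|xA] := boolP (x \in A).
    rewrite mule1; congr (Q _); apply/seteqP; split => y /= => [[]//|By].
    by split => //; exact: set_mem.
  rewrite mule0 -(measure0 Q); congr (Q _).
  apply/seteqP; split => y //= -[Ax _].
  by move: xA; rewrite mem_set.
rewrite ge0_integralZl//; last first.
  by apply/measurable_EFinP; exact: measurable_indic.
by rewrite integral_indic// setIT muleC.
Qed.

End Slices.

(** * Measures on a product determined by open rectangles *)

Section Exhaustion.
Local Open Scope ereal_scope.
Context d (T : measurableType d) (R : realType).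
Variable m : {measure set T -> \bar R}.

Lemma ge0_integral_eq0P (D : set T) (f : T -> \bar R) :
  measurable D -> measurable_fun D f -> (forall x, D x -> 0 <= f x) ->
  (\int[m]_(x in D) f x = 0) <-> (m (D `&` [set x | 0 < f x]) = 0).
Proof.
move=> mD mf f0.
have -> : \int[m]_(x in D) f x = \int[m]_(x in D) `|f x|.
  by apply: eq_integral => x /set_mem Dx; rewrite gee0_abs// f0.
have mDf : measurable (D `&` [set x | 0 < f x]).
  exact: emeasurable_fun_o_infty.
rewrite ae_eq_integral_abs//; split => [|H].
  move=> [N [mN N0 subN]]; apply: (subset_measure0 _ mN _ N0) => //.
  move=> x [Dx /= fx]; apply: subN => /= /(_ Dx) fx0.
  by rewrite fx0 ltxx in fx.
exists (D `&` [set x | 0 < f x]); split => // x /= /not_implyP[Dx fx].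
split => //; rewrite lt_neqAle f0// andbT; apply/eqP => fx0; exact: fx.
Qed.

(** [W] is the union of a sequence whose measures tend to the supremum of [m]
    over [F]: enlarging [W] by another member cannot increase its measure. *)
Lemma exhaustion (F : set (set T)) :
  m setT < +oo -> F `<=` measurable -> F set0 ->
  (forall A : (set T)^nat, (forall n, F (A n)) -> F (\bigcup_n A n)) ->
  exists W, F W /\ forall A, F A -> m (A `\` W) = 0.
Proof.
move=> moo mF F0 FU; pose S := [set m A | A in F].
have [|u Su uS] := @ereal_sup_seq _ S.
  by apply/set0P; exists (m set0), set0.
have /choice[A FA] : forall n, exists A, F A /\ m A = u n.
  by move=> n; have [A FA <-] := Su n; exists A.
pose W := \bigcup_n A n.
have FW : F W by apply: FU => n; have [] := FA n.
have mW : measurable W by exact: mF.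
have SW : ereal_sup S <= m W.
  apply: (cvge_to_le uS); apply: nearW => n.
  have [FAn <-] := FA n; apply: le_measure; rewrite ?inE//; first exact: mF.
  exact: bigcup_sup.
exists W; split => // B FB.
have mB : measurable B by exact: mF.
have FBW : F (W `|` B).
  by rewrite -bigcup2E; apply: FU => -[|[|n]].
have : m (W `|` B) <= m W.
  by apply: le_trans SW; apply: ereal_sup_ubound; exists (W `|` B).
have fW : m W \is a fin_num.
  rewrite ge0_fin_numE//; apply: le_lt_trans moo.
  by apply: le_measure; rewrite ?inE.
have -> : W `|` B = W `|` (B `\` W).
  apply/seteqP; split => x [Wx|]; [by left| |by left|by move=> [Bx _]; right].
  by move=> Bx; have [Wx|nWx] := pselect (W x); [left|right].
rewrite measureU//.
- rewrite -[leRHS]adde0 leeD2lE// => BW0.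
  by apply/eqP; rewrite eq_le BW0 measure_ge0.
- exact: measurableD.
- by rewrite setDE setICA setICr setI0.
Qed.

End Exhaustion.

Section RectSmooth.
Local Open Scope ereal_scope.
Variables (R : realType) (X Y : ptopologicalType).

(** A form of tau-additivity along the rectangles inside an open set: an open
    [W] that contains them all up to null sets contains their union up to a
    null set.  Stated with a difference, it needs no directed families. *)
Definition rect_smooth (m : set (X * Y)%type -> \bar R) :=
  forall U W : set (X * Y)%type, open U -> open W -> W `<=` U ->
    (forall (A : set X) (B : set Y), open A -> open B -> A `*` B `<=` U ->
      m ((A `*` B) `\` W) = 0) ->
    m (U `\` W) = 0.

Let rects : set (set (X * Y)%type) :=
  [set C | exists (A : set X) (B : set Y), [/\ open A, open B & C = A `*` B]].

Let rect_smooth_le (m1 m2 : {measure set (borel (X * Y)%type) -> \bar R}) U :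
  m1 setT < +oo -> m2 setT < +oo ->
  (forall (A : set X) (B : set Y), open A -> open B ->
     m1 (A `*` B) = m2 (A `*` B)) ->
  rect_smooth m1 -> open U -> m1 U <= m2 U.
Proof.
move=> m1oo m2oo m12 sm1 oU.
have rectsm : rects `<=` (measurable : set (set (borel (X * Y)%type))).
  by move=> _ [A [B [oA oB ->]]]; apply: open_borel; exact: open_rect.
have m12s : forall E, <<s rects >> E -> m1 E = m2 E.
  move=> E sE; have := @g_sigma_algebra_measure_unique _ R (borel (X * Y)%type)
    rects rectsm (fun=> setT) _ _ m1 m2 _ _ _ E sE; apply => //.
  - by exists setT, setT; split; rewrite ?setXTT//; exact: openT.
  - by apply/seteqP; split => // x _; exists 0%N.
  - move=> _ _ [A [B [oA oB ->]]] [A' [B' [oA' oB' ->]]].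
    by exists (A `&` A'), (B `&` B'); split; rewrite ?setXI//; exact: openI.
  - by move=> _ [A [B [oA oB ->]]]; exact: m12.
(* Open sets that belong to the product sigma-algebra are stable under countable
   unions, contain the rectangles, and have the same measure under [m1] and
   [m2]: one of them exhausts [U] for [m1]. *)
pose F := [set W : set (X * Y)%type | [/\ open W, W `<=` U & <<s rects >> W]].
have [||A FA|W [[oW WU sW] Wmax]] := @exhaustion _ _ _ m1 F m1oo.
- by move=> W [oW _ _]; exact: open_borel.
- split; [exact: open0|exact: sub0set|].
  by have [] := @smallest_sigma_algebra _ setT rects.
- split.
  + by apply: bigcup_open => n _; have [] := FA n.
  + by apply: bigcup_sub => n _; have [] := FA n.
  + by apply: sigma_algebra_bigcup => n; have [] := FA n.
have mU := open_borel oU; have mW := open_borel oW.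
have UW0 : m1 (U `\` W) = 0.
  apply: sm1 => // A B oA oB ABU; apply: Wmax; split => //.
    exact: open_rect.
  by apply: sub_sigma_algebra; exists A, B.
have -> : m1 U = m1 W.
  by rewrite -[in LHS](setDUK WU) measureU0//; exact: measurableD.
by rewrite (m12s _ sW); apply: le_measure; rewrite ?inE.
Qed.

Lemma rect_smooth_unique
    (m1 m2 : {measure set (borel (X * Y)%type) -> \bar R}) :
  m1 setT < +oo ->
  (forall (A : set X) (B : set Y), open A -> open B ->
     m1 (A `*` B) = m2 (A `*` B)) ->
  rect_smooth m1 -> rect_smooth m2 ->
  forall E, measurable E -> m1 E = m2 E.
Proof.
move=> m1oo m12 s1 s2.
have m2oo : m2 setT < +oo.
  by rewrite -setXTT -m12 ?setXTT//; exact: openT.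
move=> E mE; have := @measure_unique _ R (borel (X * Y)%type)
  (@open (X * Y)%type) (fun=> setT) _ _ _ _ m1 m2 _ _ E mE; apply => //.
- exact: openI.
- by move=> _; exact: openT.
- by apply/seteqP; split => // x _; exists 0%N.
- move=> U oU; apply/eqP; rewrite eq_le; apply/andP; split.
  + exact: rect_smooth_le.
  + by apply: rect_smooth_le => // A B oA oB; rewrite m12.
Qed.

Lemma regular_rect_smooth (N : probability (borel (X * Y)%type) R) :
  hausdorff_space (X * Y)%type -> regular_measure N -> rect_smooth N.
Proof.
move=> hXY rN U W oU oW WU N0; apply: regular_locally_null => //.
  by apply: measurableD; exact: open_borel.
move=> p [Up _]; have [A [B [oA oB ABp ABU]]] := open_subrect oU Up.
exists (A `*` B); split => //; first exact: open_rect.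
by rewrite setIC setIDA (setIidl ABU) N0.
Qed.

(** The slices of [U `\` W] are null unless some rational [q] separates [Q W_x]
    from [Q U_x].  The set [E q] of those [x] is locally null: near [x], [U]
    contains a rectangle [A `*` B] with [Q B > q], and [W] contains almost all
    of it, so that [Q W_x' > q] for almost all [x'] in [A]. *)
Lemma iterated_rect_smooth (P : probability (borel X) R)
    (Q : probability (borel Y) R) (hX : hausdorff_space X)
    (hY : hausdorff_space Y) (rP : regular_measure P)
    (rQ : regular_measure Q) : rect_smooth (iterated hY rQ P).
Proof.
move=> U W oU oW WU N0.
have mU := open_borel oU; have mW := open_borel oW.
have mQ (B : set (borel (X * Y)%type)) :=
  @measurable_slice_measure R X Y hY Q rQ B.
have mslice (B : set (borel (X * Y)%type)) x : measurable B ->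
  measurable ([set y | B (x, y)] : set (borel Y)) by exact: measurable_slice.
have nullP (B : set (borel (X * Y)%type)) : measurable B ->
    (iterated hY rQ P B = 0 <-> P [set x | 0 < Q [set y | B (x, y)]] = 0).
  move=> mB; rewrite iteratedE ge0_integral_eq0P ?setTI//.
  exact: mQ.
apply/nullP; first exact: measurableD.
pose E (q : rat) : set (borel X) :=
  [set x | Q [set y | W (x, y)] <= (ratr q)%:E < Q [set y | U (x, y)]].
have mE q : measurable (E q).
  rewrite (_ : E q = (setT `&` [set x | Q [set y | W (x, y)] <= (ratr q)%:E])
     `&` (setT `&` [set x | (ratr q)%:E < Q [set y | U (x, y)]])); last first.
    rewrite !setTI; apply/seteqP.
    by split => x; [move/andP|move=> ?; exact/andP].
  apply: measurableI.
    by apply: emeasurable_fun_infty_c => //; exact: mQ.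
  by apply: emeasurable_fun_o_infty => //; exact: mQ.
have E0 q : P (E q) = 0.
  apply: regular_locally_null => // x /andP[_ qU].
  have [A [B [oA oB Ax ABU qB]]] := slice_subrect hY rQ oU qU.
  exists A; split => //.
  have mAB : measurable (A `*` B : set (borel (X * Y)%type)).
    by apply: open_borel; exact: open_rect.
  have mABW := measurableD mAB mW.
  apply: (subset_measure0 _ _ _ ((nullP _ mABW).1 (N0 A B oA oB ABU))).
  - by apply: measurableI => //; exact: open_borel.
  - rewrite -[X in measurable X]setTI; apply: emeasurable_fun_o_infty => //.
    exact: mQ.
  move=> x' [/andP[Wq _] Ax'] /=; rewrite lt0e measure_ge0 andbT.
  apply/eqP => ABW0; have : Q B <= Q [set y | W (x', y)].
    have <- : Q ([set y | W (x', y)] `|` [set y | ((A `*` B) `\` W) (x', y)])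
            = Q [set y | W (x', y)].
      by rewrite measureU0//; exact: mslice.
    apply: le_measure; rewrite ?inE//; first exact: open_borel.
      by apply: measurableU; exact: mslice.
    by move=> y By; have [Wy|nWy] := pselect (W (x', y)); [left|right].
  by move=> /le_trans/(_ Wq); rewrite leNgt qB.
have QUE x : Q [set y | U (x, y)] =
    Q [set y | W (x, y)] + Q [set y | (U `\` W) (x, y)].
  rewrite -measureU; last 3 first.
  - exact: mslice.
  - by apply: mslice; exact: measurableD.
  - by apply/seteqP; split => y //= -[? []].
  congr (Q _); apply/seteqP; split => y /=; last by move=> [/WU|[]].
  by move=> Uy; have [Wy|nWy] := pselect (W (x, y)); [left|right].
have fW x : Q [set y | W (x, y)] \is a fin_num.
  by apply: fin_num_measure; exact: mslice.
have fU x : Q [set y | U (x, y)] \is a fin_num.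
  by apply: fin_num_measure; exact: mslice.
have -> : [set x | 0 < Q [set y | (U `\` W) (x, y)]] =
    \bigcup_(n in setT) E (odflt (0%R : rat) (choice.unpickle n)).
  apply/seteqP; split => [x /= D0|x [n _ /andP[Wq qU]] /=]; last first.
    by move: (le_lt_trans Wq qU); rewrite QUE lteDl.
  have : Q [set y | W (x, y)] < Q [set y | U (x, y)] by rewrite QUE lteDl.
  rewrite -(fineK (fW x)) -(fineK (fU x)) lte_fin => /rat_in_itvoo[q].
  rewrite in_itv/= => /andP[Wq qU]; exists (choice.pickle q) => //=.
  rewrite choice.pickleK/= /E/= -(fineK (fW x)) -(fineK (fU x)).
  by rewrite lte_fin lee_fin qU ltW.
have mUE :
    measurable (\bigcup_(n in setT) E (odflt (0%R : rat) (choice.unpickle n))).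
  exact: bigcup_measurable.
apply: (negligibleP P mUE).1; apply: negligible_bigcup => n.
exact: (negligibleP P (mE _)).2 (E0 _).
Qed.

End RectSmooth.

(** * Fubini's theorem for Borel sets of a product *)

Section Fubini.
Local Open Scope ereal_scope.
Variables (R : realType) (X Y : ptopologicalType).
Variables (hX : hausdorff_space X) (hY : hausdorff_space Y).
Variables (P : probability (borel X) R) (Q : probability (borel Y) R).
Variables (rP : regular_measure P) (rQ : regular_measure Q).

Let iterated_setT : iterated hY rQ P setT < +oo.
Proof.
by rewrite -setXTT iterated_rect// !probability_setT mul1e ltry.
Qed.

Lemma regular_productE (N : probability (borel (X * Y)%type) R) B :
  is_product_measure P Q N -> measurable B ->
  N B = \int[P]_x Q [set y | B (x, y)].
Proof.
move=> [rN NPQ] mB; apply/esym.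
apply: (@rect_smooth_unique _ _ _ (iterated hY rQ P) N) => //.
- move=> A' B' /open_borel mA' /open_borel mB'.
  by rewrite iterated_rect//; apply/esym/NPQ.
- exact: iterated_rect_smooth.
- by apply: regular_rect_smooth => //; exact: hausdorff_prod.
Qed.

Let continuous_swap (S T : topologicalType) :
  continuous (fun p : S * T => (p.2, p.1)).
Proof.
by apply: continuous_pair; [exact: continuous_snd|exact: continuous_fst].
Qed.

Let column (y : borel Y) : {measure set (borel (X * Y)%type) -> \bar R} :=
  image_prob (@continuous_coslice X Y y) P.

Lemma fubini_borel (B : set (borel (X * Y)%type)) :
  measurable B ->
  \int[P]_x Q [set y | B (x, y)] = \int[Q]_y P [set x | B (x, y)].
Proof.
move: B.
have mcol (B : set (borel (X * Y)%type)) : measurable B ->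
    measurable_fun [set: borel Y] (column ^~ B).
  move=> mB; apply: (@measurable_slice_measure R Y X hX P rP
    ((fun p : Y * X => (p.2, p.1)) @^-1` B)).
  by apply: borel_preimage => //; exact: continuous_swap.
pose col := mixture Q measurableT mcol.
(* [col] is the image of an iterated integral over [Y * X] by the swap, and
   inherits its properties. *)
have colE (C : set (X * Y)) (D : set (Y * X)) :
    (forall y x, D (y, x) <-> C (x, y)) -> col C = iterated hX rP Q D.
  move=> CD; apply: eq_integral => y _.
  change (P [set x | C (x, y)] = P [set x | D (y, x)]).
  by congr (P _); apply/seteqP; split => x /= /CD.
apply: (@rect_smooth_unique _ _ _ (iterated hY rQ P) col) => //.
- move=> A B oA oB; have mA := open_borel oA; have mB := open_borel oB.
  rewrite iterated_rect// muleC -(iterated_rect hX rP Q mB mA).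
  by apply/esym/colE => y x; split => -[].
- exact: iterated_rect_smooth.
- move=> U W oU oW WU N0.
  have /continuousP csw := @continuous_swap Y X.
  pose U' := (fun p : Y * X => (p.2, p.1)) @^-1` U.
  pose W' := (fun p : Y * X => (p.2, p.1)) @^-1` W.
  transitivity (iterated hX rP Q (U' `\` W')); first exact: colE.
  apply: iterated_rect_smooth => //; [exact: csw|exact: csw| |].
    by move=> [y x] /WU.
  move=> A B oA oB ABU; transitivity (col ((B `*` A) `\` W)).
    by apply/esym/colE => y x; split => -[[/= ? ?] ?].
  by apply: N0 => // -[x y] [/= Bx Ay]; apply: (ABU (y, x)).
Qed.

End Fubini.

(** * Haar measure *)

Lemma integral_probability_cst d (T : measurableType d) (R : realType)
  (P : probability T R) (c : \bar R) : (\int[P]_x cst c x = c)%E.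
Proof. by rewrite integral_cst//= probability_setT mule1. Qed.

Section Haar.
Local Open Scope ereal_scope.
Variables (R : realType) (Omega : topologicalGroupType).
Hypothesis hO : hausdorff_space Omega.
Implicit Types (w : Omega) (A : set (borel Omega)).

Lemma continuous_mul (T : topologicalType) (f g : T -> Omega) :
  continuous f -> continuous g -> continuous (fun t => (f t * g t)%g).
Proof.
move=> cf cg t.
apply: (@continuous_comp _ _ _ (fun t => (f t, g t))
  (fun p : Omega * Omega => (p.1 * p.2)%g)).
  exact: continuous_pair.
exact: mulg_continuous.
Qed.

Lemma continuous_mull w : continuous (fun v : Omega => (w * v)%g).
Proof.
by apply: continuous_mul => t; [exact: cst_continuous|exact: cvg_id].
Qed.

Lemma continuous_mulr w : continuous (fun v : Omega => (v * w)%g).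
Proof.
by apply: continuous_mul => t; [exact: cvg_id|exact: cst_continuous].
Qed.

Variable eta : probability (borel Omega) R.
Hypothesis haar_eta : normalized_haar eta.

Let r_eta : regular_measure eta. Proof. by have [] := haar_eta. Qed.

Lemma haar_mull w A : measurable A -> eta [set v | A (w * v)%g] = eta A.
Proof.
move=> mA; rewrite -(haar_eta.2 w^-1%g A mA); congr (eta _).
apply/seteqP; split => [v /= Awv|v /= [u Au <-]]; last by rewrite mulVKg.
by exists (w * v)%g => //; rewrite mulKg.
Qed.

(** The image [rho] of [eta] under inversion is right invariant.  Integrate the
    indicator of [{(v, w) | v w \in A}] against [rho] in [v] and [eta] in [w]:
    left invariance of [eta] gives [eta A], right invariance of [rho] gives
    [rho A]. *)
Lemma haar_inv A : measurable A -> eta [set v | A v^-1%g] = eta A.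
Proof.
move=> mA.
pose rho := image_prob (@invg_continuous Omega) eta.
have r_rho : regular_measure rho by exact: regular_image.
have mAi : measurable ([set v | A v^-1%g] : set (borel Omega)).
  by apply: borel_preimage => //; exact: invg_continuous.
have rho_mulr w : rho [set v | A (v * w)%g] = rho A.
  change (eta [set v | A (v^-1 * w)%g] = eta [set v | A v^-1%g]).
  rewrite -(haar_mull w^-1%g mAi); congr (eta _).
  by apply/seteqP; split => v /=; rewrite invgM invgK.
have mAmul : measurable ((fun p : Omega * Omega => (p.1 * p.2)%g) @^-1` A :
    set (borel (Omega * Omega)%type)).
  by apply: borel_preimage => //; exact: mulg_continuous.
transitivity (\int[eta]_w rho [set v | A (v * w)%g]).
  by rewrite (eq_integral (cst (rho A))) ?integral_probability_cst.
transitivity (\int[rho]_v eta [set w | A (v * w)%g]).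
  exact/esym/(fubini_borel hO hO r_rho r_eta mAmul).
rewrite (eq_integral (cst (eta A))) ?integral_probability_cst// => v _.
exact: haar_mull.
Qed.

Lemma haar_mulr w A : measurable A -> eta [set v | A (v * w)%g] = eta A.
Proof.
move=> mA.
have mAi : measurable ([set v | A v^-1%g] : set (borel Omega)).
  by apply: borel_preimage => //; exact: invg_continuous.
have mAw : measurable ([set v | A (v * w)%g] : set (borel Omega)).
  by apply: borel_preimage => //; exact: continuous_mulr.
rewrite -(haar_inv mA) -(haar_inv mAw) -(haar_mull w^-1%g mAi); congr (eta _).
by apply/seteqP; split => v /=; rewrite invgM invgK.
Qed.

(** If [V] were null, all its translates would be, and the whole group would be
    locally null. *)
Lemma haar_open_gt0 (V : set Omega) : open V -> V 1%g -> 0 < eta V.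
Proof.
move=> oV V1; rewrite lt0e measure_ge0 andbT; apply/eqP => V0.
have : eta setT = 0.
  apply: regular_locally_null => // w _; exists [set v | V (w^-1 * v)%g].
  have mV := open_borel oV.
  have /continuousP cw := @continuous_mull w^-1%g.
  split; [exact: cw|by rewrite /= mulVg|].
  by rewrite setTI; have := haar_mull w^-1%g mV => ->.
by rewrite probability_setT => /eqP; rewrite onee_eq0.
Qed.

End Haar.

(** * Absolutely continuous invariant measures of an ergodic system *)

Section ErgodicExtremal.
Local Open Scope ereal_scope.
Context d (T : measurableType d) (R : realType).

Lemma mnormalizeE (m : {measure set T -> \bar R}) (P : probability T R) c A :
  m setT = c -> 0 < c -> c < +oo ->
  mnormalize m P A = m A * (fine c)^-1%:E.
Proof.
by move=> mT c0 coo; rewrite /mnormalize mT (gt_eqF c0) (lt_eqF coo).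
Qed.

Lemma measure_setD_sym (m : {finite_measure set T -> \bar R}) A B :
  measurable A -> measurable B -> m A = m B -> m (A `\` B) = m (B `\` A).
Proof.
move=> mA mB AB; rewrite !measureD//; last 2 first.
- by rewrite -ge0_fin_numE// fin_num_measure.
- by rewrite -ge0_fin_numE// fin_num_measure.
by rewrite /= AB setIC.
Qed.

Variables nu lam : probability T R.

Lemma probability_le_eq :
  (forall A, measurable A -> lam A <= nu A) ->
  forall A, measurable A -> lam A = nu A.
Proof.
move=> le A mA; apply/eqP; rewrite eq_le le//=.
have := le _ (measurableC mA); rewrite !probability_setC//.
have fl : lam A \is a fin_num by exact: fin_num_measure.
have fn : nu A \is a fin_num by exact: fin_num_measure.
by rewrite -(fineK fl) -(fineK fn) -!EFinB !lee_fin lerD2l lerN2.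
Qed.

Variables (I : Type) (S : I -> T -> T).
Hypothesis mS : forall g, measurable_fun setT (S g).
Hypothesis inv_nu : forall g A, measurable A -> nu A = nu (S g @^-1` A).
Hypothesis inv_lam : forall g A, measurable A -> lam A = lam (S g @^-1` A).
Hypothesis ergodic_nu : forall A, measurable A ->
  (forall g, nu ((A `\` (S g @^-1` A)) `|` ((S g @^-1` A) `\` A)) = 0) ->
  nu A = 0 \/ nu A = 1.

(** Let [h] be the density of [lam] and [P = {h > 1}].  Invariance of both
    measures makes the two halves of the symmetric difference of [P] and its
    preimage [P'] equal in [nu] and equal in [lam].  On [P' `\` P] the density
    is at most [1], so [lam (P `\` P') <= nu (P `\` P')]; as the density exceeds
    [1] there, [P `\` P'] is null.  By ergodicity [P] is null or conull, and
    conull is impossible for probabilities, so [lam <= nu]. *)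
Lemma ergodic_extremal : lam `<< nu ->
  forall A, measurable A -> lam A = nu A.
Proof.
move=> lamnu.
pose h := Radon_Nikodym_SigmaFinite.f lam nu.
have h0 x : 0 <= h x by exact: Radon_Nikodym_SigmaFinite.f_ge0.
have hfin x : h x \is a fin_num by exact: Radon_Nikodym_SigmaFinite.f_fin_num.
have mh : measurable_fun setT h.
  exact: measurable_int (Radon_Nikodym_SigmaFinite.f_integrable lamnu).
have hE A : measurable A -> lam A = \int[nu]_(x in A) h x.
  exact: Radon_Nikodym_SigmaFinite.f_integral.
have above A : measurable A -> A `<=` [set x | 1 < h x] ->
    lam A <= nu A -> nu A = 0.
  move=> mA Ah; rewrite (hE _ mA).
  have h10 x : A x -> 0 <= h x - 1 by move=> /Ah/ltW; rewrite sube_ge0.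
  have mh1 : measurable_fun A (fun x => h x - 1).
    by apply: emeasurable_funB => //; apply: measurable_funTS.
  have -> : \int[nu]_(x in A) h x = \int[nu]_(x in A) (1 + (h x - 1)).
    by apply: eq_integral => x _; rewrite addeC subeK.
  rewrite ge0_integralD//= integral_cst//= mul1e.
  rewrite -[leRHS]adde0 leeD2lE ?fin_num_measure// => I0.
  have : \int[nu]_(x in A) (h x - 1) = 0.
    by apply/eqP; rewrite eq_le I0 integral_ge0.
  move/ge0_integral_eq0P => /(_ mA mh1 h10) <-; congr (nu _).
  apply/seteqP; split => [x Ax|x []//]; split => //.
  change (0 < h x - 1); rewrite sube_gt0; exact: Ah.
have below A : measurable A -> A `<=` [set x | h x <= 1] -> lam A <= nu A.
  move=> mA Ah; rewrite (hE _ mA).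
  apply: (@le_trans _ _ (\int[nu]_(x in A) cst 1 x)).
    by apply: ge0_le_integral => //; exact: measurable_funTS.
  by rewrite integral_cst//= mul1e.
pose P := [set x | 1 < h x].
have mP : measurable P.
  by rewrite -[P]setTI; apply: emeasurable_fun_o_infty.
have P01 : nu P = 0 \/ nu P = 1.
  apply: ergodic_nu => // g.
  have mP' : measurable (S g @^-1` P).
    by rewrite -[X in measurable X]setTI; exact: mS.
  have nuD : nu (P `\` (S g @^-1` P)) = nu ((S g @^-1` P) `\` P).
    by apply: measure_setD_sym => //; exact: inv_nu.
  have lamD : lam (P `\` (S g @^-1` P)) = lam ((S g @^-1` P) `\` P).
    by apply: measure_setD_sym => //; exact: inv_lam.
  have D0 : nu (P `\` (S g @^-1` P)) = 0.
    apply: above; [exact: measurableD|by move=> x []|].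
    rewrite lamD nuD; apply: below; first exact: measurableD.
    by move=> x [_ /= /negP]; rewrite -leNgt.
  rewrite measureU0; [exact: D0|exact: measurableD|exact: measurableD|].
  exact: etrans (esym nuD) D0.
have P0 : nu P = 0.
  case: P01 => // P1; apply: above => //; rewrite P1; exact: probability_le1.
apply: probability_le_eq => A mA.
have /null_content_dominatesP lamnu' := lamnu.
rewrite (measureDI lam mA mP) [X in _ + X]lamnu'; last 2 first.
- exact: measurableI.
- apply: (subset_measure0 _ _ _ P0) => //; exact: measurableI.
rewrite adde0; apply: (@le_trans _ _ (nu (A `\` P))).
  apply: below; first exact: measurableD.
  by move=> x [_ /= /negP]; rewrite -leNgt.
by apply: le_measure; rewrite ?inE//; exact: measurableD.
Qed.

End ErgodicExtremal.

(** * Invariant measures of the skew product *)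

Section SkewProduct.
Local Open Scope ereal_scope.
Variables (R : realType) (G : semitopologicalSemigroupType).
Variables (K : ptopologicalType) (Omega : topologicalGroupType).
Variables (act : G -> K -> K) (gamma : G -> K -> Omega).
Variables (mu : probability (borel K) R) (eta : probability (borel Omega) R).
Variable nu : probability (borel (K * Omega)%type) R.
Hypotheses (hK : hausdorff_space K) (hO : hausdorff_space Omega).
Hypotheses (actK : is_action act) (gammaK : is_cocycle act gamma).
Hypothesis uergK : uniquely_ergodic_with act mu.
Hypothesis haar_eta : normalized_haar eta.
Hypothesis prod_nu : is_product_measure mu eta nu.

Local Notation S := (skew_product act gamma).

Let r_eta : regular_measure eta. Proof. by case: haar_eta. Qed.
Let r_mu : regular_measure mu. Proof. by case: uergK. Qed.
Let r_nu : regular_measure nu. Proof. by case: prod_nu. Qed.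
Let hKO : hausdorff_space (K * Omega)%type. Proof. exact: hausdorff_prod. Qed.

Let continuous_act g : continuous (act g).
Proof. exact: continuous_compose (@continuous_slice G K g) actK.1. Qed.

Let continuous_gamma g : continuous (gamma g).
Proof. exact: continuous_compose (@continuous_slice G K g) gammaK.1. Qed.

Lemma continuous_skew g : continuous (S g).
Proof.
have cact := continuous_compose (@continuous_fst K Omega) (@continuous_act g).
have cgam := continuous_compose (@continuous_fst K Omega) (@continuous_gamma g).
exact: continuous_pair cact (continuous_mul (@continuous_snd K Omega) cgam).
Qed.

(** Fibrewise, the skew product acts by a right translation, which preserves
    [eta], and on the base it preserves [mu]. *)
Lemma product_invariant : invariant_measure S nu.
Proof.
move=> g B mB.
have mSB : measurable (S g @^-1` B : set (borel (K * Omega)%type)).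
  by apply: borel_preimage => //; exact: continuous_skew.
rewrite !(regular_productE hK hO r_mu r_eta prod_nu)//.
have [_ inv_mu _] := uergK.
rewrite -(integral_image (@continuous_act g) (inv_mu g))//; last first.
  exact: measurable_slice_measure.
apply: eq_integral => x _; apply/esym.
exact: (haar_mulr hO haar_eta (gamma g x) (measurable_slice (act g x) mB)).
Qed.

Let rot (w : Omega) (p : (K * Omega)%type) : (K * Omega)%type :=
  (p.1, (w * p.2)%g).

Let continuous_rotate :
  continuous (fun q : Omega * (K * Omega) => rot q.1 q.2).
Proof.
have csnd := @continuous_snd Omega (K * Omega)%type.
apply: continuous_pair.
  exact: continuous_compose csnd (@continuous_fst K Omega).
apply: continuous_mul; first exact: continuous_fst.
exact: continuous_compose csnd (@continuous_snd K Omega).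
Qed.

Let continuous_rot w : continuous (rot w).
Proof.
exact: continuous_compose (@continuous_slice Omega (K * Omega)%type w)
  continuous_rotate.
Qed.

Let mrotate B : measurable (B : set (borel (K * Omega)%type)) ->
  measurable ((fun q : Omega * (K * Omega) => rot q.1 q.2) @^-1` B :
    set (borel (Omega * (K * Omega))%type)).
Proof. by move=> mB; apply: borel_preimage => //; exact: continuous_rotate. Qed.

Variable lam : probability (borel (K * Omega)%type) R.
Hypotheses (r_lam : regular_measure lam) (inv_lam : invariant_measure S lam).

Lemma fst_invariant A : measurable (A : set (borel K)) ->
  mu A = lam (fst @^-1` A).
Proof.
move=> mA; have [_ _ uniq_mu] := uergK.
rewrite -(uniq_mu (image_prob (@continuous_fst K Omega) lam))//.
  exact: regular_image.
move=> g B mB.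
change (lam (fst @^-1` B) = lam (S g @^-1` (fst @^-1` B))).
by apply: inv_lam; apply: borel_preimage => //; exact: continuous_fst.
Qed.

(** By Fubini, integrate over [w] first: for fixed [(x, v)] the rotation
    parameter enters through a right translation by [v], so the inner integral
    is [eta B_x], which sees only the projection of [lam] to [K]. *)
Lemma haar_average B : measurable (B : set (borel (K * Omega)%type)) ->
  \int[eta]_w lam (rot w @^-1` B) = nu B.
Proof.
move=> mB; transitivity (\int[lam]_p eta [set w | B (rot w p)]).
  exact: (fubini_borel hO hKO r_eta r_lam (mrotate mB)).
rewrite (regular_productE hK hO r_mu r_eta prod_nu)//.
rewrite -(integral_image (@continuous_fst K Omega) fst_invariant)//; last first.
  exact: measurable_slice_measure.
apply: eq_integral => p _.
exact: (haar_mulr hO haar_eta p.2 (measurable_slice p.1 mB)).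
Qed.

Let rotated (w : borel Omega) :
    {measure set (borel (K * Omega)%type) -> \bar R} :=
  image_prob (@continuous_rot w) lam.

Let measurable_rotated B : measurable (B : set (borel (K * Omega)%type)) ->
  measurable_fun [set: borel Omega] (rotated ^~ B).
Proof.
move=> mB.
exact: (@measurable_slice_measure R Omega (K * Omega)%type hKO lam r_lam _
  (mrotate mB)).
Qed.

(** The normalised local average is invariant because rotations commute with the
    skew product, and it is bounded by [nu B / eta V] by [haar_average], hence
    absolutely continuous. *)
Lemma local_haar_average (V : set Omega) B : ergodic S nu ->
  open V -> V 1%g -> measurable (B : set (borel (K * Omega)%type)) ->
  \int[eta]_(w in V) lam (rot w @^-1` B) = eta V * nu B.
Proof.
move=> erg oV V1 mB; have mV := open_borel oV.
have V_gt0 := haar_open_gt0 hO haar_eta oV V1.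
have fV : eta V \is a fin_num by exact: fin_num_measure.
pose m := mixture eta mV measurable_rotated.
have mT : m [set: borel (K * Omega)%type] = eta V.
  rewrite /m /mixture (eq_integral (cst 1)) => [|w _]; last first.
    exact: probability_setT.
  by rewrite integral_cst//= mul1e.
pose lamV : probability (borel (K * Omega)%type) R := mnormalize m nu.
have lamVE A : lamV A = m A * (fine (eta V))^-1%:E.
  by apply: mnormalizeE => //; rewrite -ge0_fin_numE.
suff : lamV B = nu B.
  rewrite lamVE => <-.
  rewrite muleC -muleA -{2}(fineK fV) -EFinM mulVf ?mule1//.
  by rewrite fine_eq0// gt_eqF.
have := @ergodic_extremal _ (borel (K * Omega)%type) R nu lamV G S
  _ _ _ _ _ B mB; apply.
- by move=> g; apply: continuous_borel; exact: continuous_skew.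
- by move=> g A mA; exact: product_invariant.
- move=> g A mA; rewrite !lamVE; congr (_ * _); apply: eq_integral => w _.
  change (lam (rot w @^-1` A) = lam (rot w @^-1` (S g @^-1` A))).
  rewrite (inv_lam g); last first.
    by apply: borel_preimage => //; exact: continuous_rot.
  congr (lam _); apply/seteqP.
  by split => -[x v]; rewrite /rot /skew_product /= mulgA.
- by move=> A mA A0; apply: erg => // g; rewrite setY_def.
apply/null_content_dominatesP => A mA A0; rewrite lamVE.
suff -> : m A = 0 by rewrite mul0e.
apply/eqP; rewrite eq_le measure_ge0 andbT.
apply: (@le_trans _ _ (\int[eta]_w lam (rot w @^-1` A))); last first.
  by rewrite (etrans (haar_average mA) A0).
apply: ge0_subset_integral => //.
exact: measurable_rotated.
Qed.

(** If [nu U < lam U], [slice_subrect] at [w = 1] gives a neighbourhood [V] of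
    [1] and a set [B] inside [rot w @^-1` U] for all [w] in [V], with
    [lam B > nu U]; the average over [V] is then too large. *)
Lemma invariant_le_product (U : set (K * Omega)) :
  ergodic S nu -> open U -> lam U <= nu U.
Proof.
move=> erg oU; rewrite leNgt; apply/negP => nulam.
have mU := open_borel oU.
pose U' := (fun q : Omega * (K * Omega) => rot q.1 q.2) @^-1` U.
have oU' : open U' by have /continuousP := continuous_rotate; exact.
have [|V [B [oV oB V1 VBU nuB]]] := @slice_subrect R Omega (K * Omega)%type hKO
    lam r_lam U' 1%g (nu U) oU'.
  rewrite (_ : [set y | _] = U)//.
  by apply/seteqP; split => -[x v]; rewrite /U' /rot /= mul1g.
have mV := open_borel oV.
have fV : eta V \is a fin_num by exact: fin_num_measure.
have : eta V * lam B <= eta V * nu U.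
  rewrite -(local_haar_average erg oV V1 mU).
  apply: (@le_trans _ _ (\int[eta]_(w in V) cst (lam B) w)).
    by rewrite integral_cst//= muleC.
  apply: ge0_le_integral => //.
    by apply: measurable_funTS; exact: measurable_rotated.
  move=> w Vw; apply: le_measure; rewrite ?inE.
  - exact: open_borel.
  - by apply: borel_preimage => //; exact: continuous_rot.
  - by move=> p Bp; exact: (VBU (w, p)).
rewrite lee_pmul2l//; last exact: haar_open_gt0.
by rewrite leNgt nuB.
Qed.

Lemma invariant_eq_product A : ergodic S nu ->
  measurable (A : set (borel (K * Omega)%type)) -> lam A = nu A.
Proof.
move=> erg; move: A; apply: probability_le_eq => A mA.
rewrite leNgt; apply/negP => /(regular_outer r_nu mA)[U [oU AU nuU]].
move: nuU; apply/negP; rewrite -leNgt.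
apply: le_trans (invariant_le_product erg oU).
by apply: le_measure; rewrite ?inE//; exact: open_borel.
Qed.

End SkewProduct.

Theorem theorem3p4 (R : realType) (G : semitopologicalSemigroupType)
    (K : ptopologicalType) (Omega : topologicalGroupType)
    (act : G -> K -> K) (gamma : G -> K -> Omega)
    (mu : probability (borel K) R) (eta : probability (borel Omega) R)
    (nu : probability (borel (K * Omega)%type) R)
    (amenG : right_amenable R G)
    (compactK : compact [set: K]) (hausdorffK : hausdorff_space K)
    (actK : is_action act) (uergK : uniquely_ergodic_with act mu)
    (compactOmega : compact [set: Omega])
    (hausdorffOmega : hausdorff_space Omega)
    (haar_eta : normalized_haar eta)
    (cocycle_gamma : is_cocycle act gamma)
    (prod_nu : is_product_measure mu eta nu) :
  ergodic (skew_product act gamma) nu ->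
  uniquely_ergodic R (skew_product act gamma).
Proof.
move=> erg; exists nu; split.
- by have [] := prod_nu.
- exact: (product_invariant hausdorffK hausdorffOmega actK cocycle_gamma uergK
    haar_eta prod_nu).
- move=> lam r_lam inv_lam A mA.
  exact: (invariant_eq_product hausdorffK hausdorffOmega actK cocycle_gamma
    uergK haar_eta prod_nu r_lam inv_lam erg).
Qed.
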